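(* For all $\varepsilon>0$ and $r\in\mathbb{N}$ there exists $n_0>0$ such that the following holds for all integers $n\ge n_0$. For every $A\subseteq[n]$ there exists $A'\subseteq A$ with $|A'|\ge |A|-\varepsilon n$ such that $$2^{g(A,r)n}\le f(A,r)\le 2^{(g(A',r)+\varepsilon)n}.$$ Consequently, $$g(n,r)\le \frac{\log f(n,r)}{n}\le g(n,r)+\varepsilon.$$
   Context: $[n]=\{1,\ldots,n\}$; logarithms are to base 2. A Schur triple (sum) in $S\subseteq\mathbb{Z}$ is a triple $\{x,y,z\}\subseteq S$ of not necessarily distinct elements with $x+y=z$; a set is sum-free if it contains no Schur triple. For $A\subseteq[n]$ and $r\in\mathbb{N}$, a colouring $\sigma:A\to[r]$ is valid if each $\sigma^{-1}(c)$ is sum-free; $f(A,r)$ is the number of valid colourings of $A$ and $f(n,r)=\max_{A\subseteq[n]}f(A,r)$. For a tuple $(A_1,\ldots,A_r)$ of sum-free subsets of $[n]$ and $\emptyset\ne I\subseteq[r]$, let $E_I=\bigcap_{i\in I}A_i\setminus\bigcup_{j\notin I}A_j$, and define $$g(A_1,\ldots,A_r)=\frac1n\sum_{\emptyset\ne I\subseteq[r]}|E_I|\log|I|$$ (equivalently $\sum_{i\in[r]}d_i\log i$, where $d_i n$ is the number of elements of $[n]$ lying in exactly $i$ of the sets $A_j$). Let $g(n,r)$ be the maximum of $g(A_1,\ldots,A_r)$ over all $r$-tuples of sum-free subsets of $[n]$, and for $A\subseteq[n]$ let $g(A,r)$ be the maximum of $g(A_1,\ldots,A_r)$ over all $r$-tuples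 of sum-free subsets of $[n]$ with $\bigcup_{i\in[r]}A_i=A$ (with the convention $\max\emptyset=-\infty$, $2^{-\infty}=0$). *)

(* Defs.v *)
From HB Require Import structures.
From mathcomp Require Import all_boot all_order all_algebra.
From mathcomp Require Import constructive_ereal reals exp.

Set Implicit Arguments.
Unset Strict Implicit.
Unset Printing Implicit Defensive.

Import Order.TTheory GRing.Theory Num.Theory.

Local Open Scope ring_scope.

(* Subsets of [n] = {1, ..., n} are encoded as sets over 'I_n.+1 = {0, ..., n}
   contained in [bracket n]; thus an element of the set is the ordinal whose
   value is the integer itself. *)
Definition bracket (n : nat) : {set 'I_n.+1} :=
  [set x : 'I_n.+1 | (0 < x)%N].

(* The addition is that of nat, not the modular one of 'I_n.+1. *)
Definition sum_free (n : nat) (S : {set 'I_n.+1}) : bool :=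
  [forall x in S, forall y in S, forall z in S, (nat_of_ord x + y != z)%N].

Definition colouring (n : nat) (A : {set 'I_n.+1}) (r : nat) : finType :=
  {ffun {x : 'I_n.+1 | x \in A} -> 'I_r}.

Definition colour_class (n : nat) (A : {set 'I_n.+1}) (r : nat)
    (s : colouring A r) (c : 'I_r) : {set 'I_n.+1} :=
  [set val x | x in s @^-1: [set c]].

Definition valid (n : nat) (A : {set 'I_n.+1}) (r : nat)
    (s : colouring A r) : bool :=
  [forall c, sum_free (colour_class s c)].

Definition f_set (n : nat) (A : {set 'I_n.+1}) (r : nat) : nat :=
  #|[set s : colouring A r | valid s]|.

Definition f_max (n r : nat) : nat :=
  \max_(A : {set 'I_n.+1} | A \subset bracket n) f_set A r.

Definition log2 (R : realType) (x : R) : R := ln x / ln 2.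

Definition exp2 (R : realType) (x : \bar R) : \bar R :=
  match x with
  | y%:E => (2 `^ y)%:E
  | +oo => +oo
  | -oo => 0
  end%E.

Definition set_tuple (n r : nat) : finType := {ffun 'I_r -> {set 'I_n.+1}}.

Definition sum_free_tuple (n r : nat) (t : set_tuple n r) : bool :=
  [forall i, (t i \subset bracket n) && sum_free (t i)].

Definition E_part (n r : nat) (t : set_tuple n r) (I : {set 'I_r}) :
    {set 'I_n.+1} :=
  (\bigcap_(i in I) t i) :\: (\bigcup_(j in ~: I) t j).

Definition g_tuple (R : realType) (n r : nat) (t : set_tuple n r) : R :=
  n%:R^-1 *
    \sum_(I : {set 'I_r} | I != set0) #|E_part t I|%:R * log2 (#|I|%:R : R).

Definition g_max (R : realType) (n r : nat) : \bar R :=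
  \big[maxe/-oo%E]_(t : set_tuple n r | sum_free_tuple t) (g_tuple R t)%:E.

(* Equal to -oo when A is not a union of r sum-free sets. *)
Definition g_set (R : realType) (n : nat) (A : {set 'I_n.+1}) (r : nat) :
    \bar R :=
  \big[maxe/-oo%E]_(t : set_tuple n r |
      sum_free_tuple t && (\bigcup_i t i == A)) (g_tuple R t)%:E.

(* Main.v *)
Require Import Defs.
From HB Require Import structures.
From mathcomp Require Import all_boot all_order all_algebra.
From mathcomp Require Import constructive_ereal reals sequences exp.
From mathcomp Require Import ring lra zify.

Set Implicit Arguments.
Unset Strict Implicit.
Unset Printing Implicit Defensive.

Import Order.TTheory GRing.Theory Num.Theory.

Local Open Scope ring_scope.

(** For the lower bound, colour each [x] with one of the indices [c] such that
    [x \in t c]; there are [2 ^ (g n)] such colourings and all are valid.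

    For the upper bound, every sum-free set lies in one of [2 ^ o(n)]
    containers, each of which is sum-free up to [o(n)] elements; the classes of
    a valid colouring lie in a tuple of containers, and the best tuple, pruned
    to sum-free sets, is the required tuple.  A container is obtained by
    repeatedly shrinking [n].  As long as the current set [F] has
    [delta n ^ 2] Schur triples, a bounded set [T] of elements of high degree of
    the sum-free set [S] gives a graph joining [y] to [y + t], of bounded degree
    and with linearly many edges, in which [S] is independent; a small [U] in [S]
    with a large neighbourhood determines a set of [|F| - c n] elements that
    still contains [S].  When [F] has fewer Schur triples, it is close to
    sum-free by the removal lemma, applied to triangles of the graph joining
    [u] to [u + s] for [s] in [F].  Triangle removal comes from a regularity
    lemma without equitability, where the energy increment is tested against
    the union of all witnesses of irregularity. *)

(** * Regularity and triangle removal *)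

(** A partition is given by the fibres of a labelling, so a cell may be empty; division by zero then
    gives it the value 0. *)
Definition dens (R : realFieldType) (W : finType) (L : eqType) (P : W -> L)
    (g : W -> R) (l : L) : R :=
  (\sum_(v | P v == l) g v) / (\sum_(v | P v == l) 1).

(** [dens P g] composed with [P] is the conditional expectation of [g], and a function of the label
    is constant on each cell. *)
Lemma sum_dens (R : realFieldType) (W : finType) (L : eqType) (P : W -> L)
    (g : W -> R) (h : L -> R) :
  \sum_w dens P g (P w) * h (P w) = \sum_w g w * h (P w).
Proof.
transitivity (\sum_w \sum_(v | P v == P w)
    g v / (\sum_(u | P u == P w) 1) * h (P w)).
  by apply: eq_bigr => w _; rewrite /dens -!big_distrl.
rewrite (exchange_big_dep predT) //=; apply: eq_bigr => v _.
transitivity (\sum_(w | P w == P v) 1 * (g v / (\sum_(u | P u == P v) 1) * h (P v))).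
  by apply: eq_big => [w|w /eqP ->]; rewrite ?mul1r // eq_sym.
rewrite -big_distrl /= mulrA mulrCA divff ?mulr1 //.
rewrite (bigD1 v) //= gt_eqF // ltr_pwDl // sumr_ge0 //.
Qed.

Definition energy (R : realFieldType) (W : finType) (L : eqType) (P : W -> L)
    (g : W -> R) : R :=
  \sum_w dens P g (P w) ^+ 2.

Lemma energy_le (R : realFieldType) (W : finType) (L : eqType) (P : W -> L)
    (g : W -> R) :
  (forall w, 0 <= g w <= 1) -> energy P g <= \sum_(w : W) 1.
Proof.
move=> g01; apply: ler_sum => w _.
have c0 : 0 < \sum_(v | P v == P w) (1 : R).
  by rewrite (bigD1 w) //= ltr_pwDl // sumr_ge0.
have d0 : 0 <= dens P g (P w).
  apply: divr_ge0; last exact: ltW.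
  by apply: sumr_ge0 => v _; case/andP: (g01 v).
have d1 : dens P g (P w) <= 1.
  rewrite ler_pdivrMr // mul1r; apply: ler_sum => v _; by case/andP: (g01 v).
by rewrite expr_le1.
Qed.

(** Pythagoras: [D], the change of conditional expectation from [P] to the finer [Q], is orthogonal
    to the coarse expectation, so the energy grows by the squared norm of [D]. A bounded test
    function that is constant on the cells of [Q] bounds this norm from below. *)
Lemma energy_increment (R : realFieldType) (W : finType) (L L' : eqType)
    (P : W -> L) (Q : W -> L') (f : L' -> L) (g : W -> R) (h : L' -> R)
    (eps : R) :
  (forall w, P w = f (Q w)) -> (forall l, h l ^+ 2 <= 1) -> 0 < eps ->
  eps * (\sum_(w : W) 1) <= \sum_w (dens P g (P w) - g w) * h (Q w) ->
  energy P g + eps ^+ 2 * (\sum_(w : W) 1) <= energy Q g.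
Proof.
move=> PQ h1 e0 hyp.
have KQ (k : L' -> R) := sum_dens Q g k.
pose D w := dens Q g (Q w) - dens P g (P w).
have E : energy Q g = energy P g + \sum_w D w ^+ 2.
  have E1 : \sum_w dens Q g (Q w) * dens P g (P w) = energy P g.
    have := KQ (fun l => dens P g (f l)).
    under eq_bigr do rewrite -PQ.
    move=> ->; under eq_bigr do rewrite -PQ.
    by rewrite -(sum_dens P g (dens P g)); apply: eq_bigr => w _; rewrite expr2.
  have -> : \sum_w D w ^+ 2 =
     energy Q g - 2 * (\sum_w dens Q g (Q w) * dens P g (P w)) + energy P g.
    rewrite /energy mulr_sumr -sumrB -big_split /=; apply: eq_bigr => w _.
    rewrite /D; ring.
  rewrite E1; ring.
rewrite E lerD2l.
have E2 : \sum_w (dens P g (P w) - g w) * h (Q w) = - \sum_w D w * h (Q w).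
  rewrite /D; under [in RHS]eq_bigr do rewrite mulrBl.
  rewrite sumrB KQ -sumrB -sumrN; apply: eq_bigr => w _; ring.
rewrite E2 in hyp.
(* Cauchy-Schwarz in linear form: [(D + eps * h) ^+ 2] is nonnegative and [h ^+ 2 <= 1]. *)
have E3 : - 2 * eps * \sum_w D w * h (Q w) <=
    \sum_w D w ^+ 2 + eps ^+ 2 * \sum_(w : W) 1.
  rewrite !mulr_sumr -big_split /=; apply: ler_sum => w _.
  have := h1 (Q w); set x := D w; set y := h (Q w) => y1.
  have : 0 <= (x + eps * y) ^+ 2 by exact: sqr_ge0.
  have : eps ^+ 2 * y ^+ 2 <= eps ^+ 2 * 1 by rewrite ler_wpM2l ?sqr_ge0.
  nra.
set s := \sum_(w : W) 1 in hyp E3 *.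
set t := \sum_w D w * h (Q w) in hyp E3.
have : eps * (eps * s) <= eps * (- t) by rewrite ler_wpM2l // ltW.
move: E3; set z := \sum_w _; nra.
Qed.

Definition pair_label (V : finType) (T : finType) (p : V -> T) (w : V * V) :
  T * T := (p w.1, p w.2).

Definition ind (R : realFieldType) (V : finType) (G : rel V) (w : V * V) : R :=
  (G w.1 w.2)%:R.

(* One-sided regularity, relative to the whole cell as in the cut norm;
   the triangle count only ever needs lower bounds. *)
Definition irregular (R : realFieldType) (V : finType) (G : rel V)
    (T : finType) (p : V -> T) (eps : R) (l : T * T) : bool :=
  [exists X : {set V} * {set V},
    eps * (\sum_(w | pair_label p w == l) 1) <
    \sum_(w | pair_label p w == l)
       (dens (pair_label p) (ind R G) l - ind R G w)
         * ((w.1 \in X.1) && (w.2 \in X.2))%:R].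

(** The label [q] records which witnesses contain a vertex, so the indicator of the union of all
    witnesses is a function of it. On each irregular cell the correlation exceeds [eps] times the
    cell, and these cells fill more than an [eps] fraction of all pairs: hence [eps ^+ 2] in the
    correlation and its square in the energy. *)
Lemma irregular_refine (R : realFieldType) (V : finType) (G : rel V)
    (T : finType) (p : V -> T) (eps : R) :
  0 < eps ->
  eps * (\sum_(w : V * V) 1) <
    \sum_(w : V * V | irregular G p eps (pair_label p w)) 1 ->
  exists q : V -> T * {set T * T} * {set T * T},
    energy (pair_label p) (ind R G) + (eps ^+ 2) ^+ 2 * (\sum_(w : V * V) 1)
      <= energy (pair_label q) (ind R G).
Proof.
move=> e0 irr.
pose body (l : T * T) (X : {set V} * {set V}) :=
  eps * (\sum_(w | pair_label p w == l) 1) <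
    \sum_(w | pair_label p w == l)
       (dens (pair_label p) (ind R G) l - ind R G w)
         * ((w.1 \in X.1) && (w.2 \in X.2))%:R.
pose X l := odflt (set0, set0) [pick X | body l X].
have XP l : irregular G p eps l -> body l (X l).
  by move=> /existsP[Y HY]; rewrite /X; case: pickP => [Z //|/(_ Y)]; rewrite /body HY.
pose q v := (p v, [set l | v \in (X l).1], [set l | v \in (X l).2]).
pose base (m : (T * {set T * T} * {set T * T}) * (T * {set T * T} * {set T * T}))
  := (m.1.1.1, m.2.1.1).
pose h m : R := ([&& irregular G p eps (base m), base m \in m.1.1.2
  & base m \in m.2.2])%:R.
exists q.
apply: (@energy_increment _ _ _ _ _ _ base _ h) => //.
- by move=> m; rewrite /h; case: (_ && _); rewrite ?expr1n ?expr0n.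
- by rewrite exprn_gt0.
have hq w : h (pair_label q w) = (irregular G p eps (pair_label p w))%:R *
   ((w.1 \in (X (pair_label p w)).1) && (w.2 \in (X (pair_label p w)).2))%:R.
  by rewrite /h /base /= !inE -natrM mulnb.
under [leRHS]eq_bigr do rewrite hq mulrCA.
have -> : eps ^+ 2 * \sum_(w : V * V) 1 = eps * (eps * \sum_(w : V * V) 1).
  by rewrite expr2 mulrA.
apply: (le_trans (ler_wpM2l (ltW e0) (ltW irr))).
rewrite big_mkcond /= mulr_sumr.
rewrite (partition_big (pair_label p) predT) //=.
rewrite [leRHS](partition_big (pair_label p) predT) //=.
apply: ler_sum => l _.
case: (boolP (irregular G p eps l)) => il; last first.
  rewrite !big1 // => w /eqP ->; rewrite (negbTE il) ?mul0r ?mulr0 //.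
apply: le_trans (_ : eps * (\sum_(w | pair_label p w == l) 1) <= _).
  by rewrite mulr_sumr; apply: ler_sum => w /eqP ->; rewrite il.
apply: (le_trans (ltW (XP _ il))); apply: ler_sum => w /eqP ->.
by rewrite il mul1r.
Qed.

Lemma card_sets (T : finType) : #|{set T}| = (2 ^ #|T|)%N.
Proof. by rewrite -!cardsT -powersetT card_powerset. Qed.

(** [m] counts the energy increments still possible and [k] bounds the number of parts. The energy
    never exceeds the number of pairs, so at [m = 0] the partition at hand must be regular. *)
Lemma regularity_aux (R : realFieldType) (eps : R) (m k : nat) :
  0 < eps ->
  exists M : nat, forall (V : finType) (G : rel V) (T : finType) (p : V -> T),
    (#|T| <= k)%N ->
    (1 - m%:R * (eps ^+ 2) ^+ 2) * (\sum_(w : V * V) 1)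
      <= energy (pair_label p) (ind R G) ->
    exists (T' : finType) (p' : V -> T'), (#|T'| <= M)%N /\
      \sum_(w : V * V | irregular G p' eps (pair_label p' w)) 1
        <= eps * (\sum_(w : V * V) 1).
Proof.
move=> e0; elim: m k => [|m IH] k.
  exists k => V G T p Tk; rewrite mul0r subr0 mul1r => en.
  exists T, p; split=> //; rewrite leNgt; apply/negP => irr.
  have [q] := irregular_refine e0 irr.
  have : energy (pair_label q) (ind R G) <= \sum_(w : V * V) 1.
    by apply: energy_le => w; rewrite /ind; case: (G _ _); rewrite ?lexx ?ler01.
  (* For empty [V] the total is 0 and the strict inequality [irr] fails. *)
  have : 0 < (eps ^+ 2) ^+ 2 * \sum_(w : V * V) (1 : R).
    rewrite mulr_gt0 ?exprn_gt0 // lt_neqAle sumr_ge0 // andbT.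
    apply/eqP => z; move: irr; rewrite -z mulr0 ltNge => /negP; apply.
    rewrite [leRHS]z [leLHS]big_mkcond.
    by apply: ler_sum => w _; case: ifP.
  lra.
(* A label of [q] consists of an old part and two sets of pairs of old parts. *)
have [M HM] := IH (k * 2 ^ (k * k) * 2 ^ (k * k))%N.
exists (maxn k M) => V G T p Tk en.
case: (leP (\sum_(w : V * V | irregular G p eps (pair_label p w)) 1)
  (eps * (\sum_(w : V * V) 1))) => irr.
  by exists T, p; split=> //; rewrite leq_max Tk.
have [q qen] := irregular_refine e0 irr.
have [|| T' [p' [T'M reg]]] := HM V G _ q.
- rewrite !card_prod !card_sets !card_prod.
  by rewrite !leq_mul ?leq_pexp2l ?leq_mul.
- move: en qen; rewrite -natr1; lra.
by exists T', p'; split=> //; rewrite leq_max T'M orbT.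
Qed.

Lemma regularity (R : archiRealFieldType) (eps : R) :
  0 < eps ->
  exists M : nat, forall (V : finType) (G : rel V),
    exists (T : finType) (p : V -> T), (#|T| <= M)%N /\
      \sum_(w : V * V | irregular G p eps (pair_label p w)) 1
        <= eps * (\sum_(w : V * V) 1).
Proof.
move=> e0.
have e4 : 0 < (eps ^+ 2) ^+ 2 by rewrite !exprn_gt0.
(* With this [m] the energy hypothesis of [regularity_aux] has a nonpositive left-hand side, so the
   one-part partition qualifies. *)
pose m := Num.bound ((eps ^+ 2) ^+ 2)^-1.
have me : 1 <= m%:R * (eps ^+ 2) ^+ 2.
  rewrite -ler_pdivrMr // mul1r; apply/ltW/archi_boundP.
  by rewrite invr_ge0 ltW.
have [M HM] := regularity_aux m 1 e0.
exists M => V G; apply: (HM V G unit (fun=> tt)); first by rewrite card_unit.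
apply: le_trans (_ : 0 <= _); last by apply: sumr_ge0 => w _; rewrite sqr_ge0.
apply: mulr_le0_ge0; first lra.
exact: sumr_ge0.
Qed.

(** * Counting triangles across regular pairs *)

Lemma sum_pair_label (R : nmodType) (V T : finType) (p : V -> T) (a b : T)
    (F : V -> V -> R) :
  \sum_(w | pair_label p w == (a, b)) F w.1 w.2 =
  \sum_(x | p x == a) \sum_(y | p y == b) F x y.
Proof. by rewrite pair_big /=; apply: eq_bigl => w; rewrite xpair_eqE. Qed.

Definition cell_size (R : realFieldType) (V T : finType) (p : V -> T) (a : T)
  : R := \sum_(x | p x == a) 1.

Lemma cell_size_ge0 (R : realFieldType) (V T : finType) (p : V -> T) (a : T) :
  0 <= cell_size R p a.
Proof. exact: sumr_ge0. Qed.

Lemma cell_size_pair (R : realFieldType) (V T : finType) (p : V -> T)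
    (a b : T) :
  \sum_(w | pair_label p w == (a, b)) 1 = cell_size R p a * cell_size R p b.
Proof.
rewrite (sum_pair_label p a b (fun _ _ => 1)) /cell_size mulr_suml.
by apply: eq_bigr => x _; rewrite mul1r.
Qed.

Lemma dens_lower (R : realFieldType) (V : finType) (G : rel V)
    (T : finType) (p : V -> T) (d : R) (a b : T) :
  d <= dens (pair_label p) (ind R G) (a, b) ->
  d * (cell_size R p a * cell_size R p b)
    <= \sum_(x | p x == a) \sum_(y | p y == b) (G x y)%:R.
Proof.
rewrite /dens cell_size_pair /ind (sum_pair_label p a b (fun x y => (G x y)%:R)).
set s := \sum_(x | _) _; set c := cell_size R p a * _ => ds.
have s0 : 0 <= s by apply: sumr_ge0 => x _; apply: sumr_ge0.
have : 0 <= c by rewrite mulr_ge0 // cell_size_ge0.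
rewrite le_eqVlt => /predU1P[<-|c0]; first by rewrite mulr0.
by rewrite -ler_pdivlMr.
Qed.

(** Regularity is tested on the sets that [f] and [g] cut out. *)
Lemma regular_lower (R : realFieldType) (V : finType) (G : rel V)
    (T : finType) (p : V -> T) (eps d : R) (a b : T) (f g : pred V) :
  ~~ irregular G p eps (a, b) ->
  d <= dens (pair_label p) (ind R G) (a, b) ->
  d * ((\sum_(x | p x == a) (f x)%:R) * (\sum_(y | p y == b) (g y)%:R))
    - eps * (cell_size R p a * cell_size R p b)
  <= \sum_(x | p x == a) \sum_(y | p y == b) (G x y)%:R * (f x && g y)%:R.
Proof.
move=> /existsPn/(_ ([set x | f x], [set y | g y])).
rewrite -leNgt cell_size_pair; set D := dens _ _ _ => reg dD.
have sE : \sum_(w | pair_label p w == (a, b))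
    (D - ind R G w) * ((w.1 \in [set x | f x]) && (w.2 \in [set y | g y]))%:R
  = D * ((\sum_(x | p x == a) (f x)%:R) * (\sum_(y | p y == b) (g y)%:R))
    - \sum_(x | p x == a) \sum_(y | p y == b) (G x y)%:R * (f x && g y)%:R.
  rewrite -(sum_pair_label p a b (fun x y => (G x y)%:R * (f x && g y)%:R)).
  rewrite mulr_suml.
  under [in RHS]eq_bigr do rewrite mulr_sumr.
  rewrite -(sum_pair_label p a b (fun x y => (f x)%:R * (g y)%:R)).
  rewrite mulr_sumr -sumrB; apply: eq_bigr => w _.
  by rewrite !inE mulrBl -natrM mulnb.
move: reg; rewrite /= sE.
set s := _ * \sum_(_ | _) _.
have : d * s <= D * s.
  by rewrite ler_wpM2r // mulr_ge0 // sumr_ge0.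
lra.
Qed.

(** Three passes: for fixed [z], regularity of [(a, b)] on the two neighbourhoods of [z]; for fixed
    [x], regularity of [(b, c)] on the whole cell [b] and the neighbourhood of [x]; then the density
    of [(a, c)]. Each of the first two loses at most [eps] times the product of the sizes, as
    [d <= 1]. *)
Lemma triangle_counting (R : realFieldType) (V : finType) (G : rel V)
    (T : finType) (p : V -> T) (eps d : R) (a b c : T) :
  0 <= eps -> 0 <= d <= 1 ->
  ~~ irregular G p eps (a, b) -> ~~ irregular G p eps (b, c) ->
  d <= dens (pair_label p) (ind R G) (a, b) ->
  d <= dens (pair_label p) (ind R G) (b, c) ->
  d <= dens (pair_label p) (ind R G) (a, c) ->
  (d ^+ 3 - 2 * eps) * (cell_size R p a * cell_size R p b * cell_size R p c)
  <= \sum_(x | p x == a) \sum_(y | p y == b) \sum_(z | p z == c)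
       [&& G x y, G y z & G x z]%:R.
Proof.
move=> e0 /andP[d0 d1] rab rbc dab dbc dac.
set ma := cell_size R p a; set mb := cell_size R p b; set mc := cell_size R p c.
have [ma0 mb0 mc0] : [/\ 0 <= ma, 0 <= mb & 0 <= mc].
  by split; exact: cell_size_ge0.
pose S2 := \sum_(z | p z == c)
  (\sum_(x | p x == a) (G x z)%:R) * (\sum_(y | p y == b) (G y z)%:R) : R.
have step1 : d * S2 - eps * (ma * mb * mc) <=
  \sum_(x | p x == a) \sum_(y | p y == b) \sum_(z | p z == c)
       [&& G x y, G y z & G x z]%:R.
  under [leRHS]eq_bigr do rewrite exchange_big /=.
  rewrite [leRHS]exchange_big /=.
  have -> : eps * (ma * mb * mc) = \sum_(z | p z == c) eps * (ma * mb).
    under eq_bigr do rewrite -[_ * (_ * _)]mulr1.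
    by rewrite -mulr_sumr -[\sum_(_ | _) 1]/mc; ring.
  rewrite /S2 mulr_sumr -sumrB; apply: ler_sum => z _.
  apply: le_trans (regular_lower (fun x => G x z) (fun y => G y z) rab dab) _.
  apply: ler_sum => x _; apply: ler_sum => y _.
  by rewrite -natrM mulnb [G x z && _]andbC.
pose S3 := \sum_(x | p x == a) \sum_(z | p z == c) (G x z)%:R : R.
have step2 : d * mb * S3 - eps * (ma * mb * mc) <= S2.
  have -> : S2 = \sum_(x | p x == a) \sum_(y | p y == b) \sum_(z | p z == c)
      (G y z)%:R * (predT y && G x z)%:R.
    under [RHS]eq_bigr do rewrite exchange_big /=.
    rewrite [RHS]exchange_big /=; apply: eq_bigr => z _.
    rewrite mulr_suml; apply: eq_bigr => x _; rewrite mulr_sumr.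
    by apply: eq_bigr => y _; rewrite mulrC.
  have -> : eps * (ma * mb * mc) = \sum_(x | p x == a) eps * (mb * mc).
    under eq_bigr do rewrite -[_ * (_ * _)]mulr1.
    by rewrite -mulr_sumr -[\sum_(_ | _) 1]/ma; ring.
  rewrite /S3 mulr_sumr -sumrB; apply: ler_sum => x _.
  apply: le_trans (regular_lower predT (fun z => G x z) rbc dbc).
  by rewrite -mulrA.
have step3 : d * (ma * mc) <= S3 by exact: dens_lower.
apply: le_trans step1.
have h1 : d * (d * mb * S3 - eps * (ma * mb * mc)) <= d * S2 by exact: ler_wpM2l.
have h2 : d * mb * (d * (ma * mc)) <= d * mb * S3.
  by rewrite ler_wpM2l // mulr_ge0.
have h3 : d * (d * mb * (d * (ma * mc))) <= d * (d * mb * S3) by exact: ler_wpM2l.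
have h4 : 0 <= eps * (ma * mb * mc) by rewrite !mulr_ge0.
have h5 : d * (eps * (ma * mb * mc)) <= eps * (ma * mb * mc).
  by rewrite ler_piMl.
move: h1 h3 h5; set E := eps * (ma * mb * mc) => h1 h3 h5.
have -> : (d ^+ 3 - 2 * eps) * (ma * mb * mc) =
  d * (d * mb * (d * (ma * mc))) - 2 * E by rewrite /E; ring.
lra.
Qed.

Lemma sum_small_cells (R : realFieldType) (V T : finType) (p : V -> T) (t : R) :
  0 <= t -> \sum_(x | cell_size R p (p x) < t) 1 <= #|T|%:R * t.
Proof.
move=> t0; rewrite (partition_big p predT) //= -sum1_card natr_sum mulr_suml.
apply: ler_sum => a _; rewrite mul1r.
case: (ltP (cell_size R p a) t) => ta; last first.
  rewrite big_pred0 // => x; apply/negbTE/negP => /andP[+ /eqP xa].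
  by rewrite xa ltNge ta.
apply: le_trans (ltW ta); rewrite /cell_size big_mkcond [leRHS]big_mkcond /=.
by apply: ler_sum => x _; case: eqP; case: (_ < _).
Qed.

Lemma sum1_pair (R : realFieldType) (V : finType) :
  \sum_(w : V * V) 1 = #|V|%:R ^+ 2 :> R.
Proof. by rewrite sumr_const cardT -cardE card_prod natrM expr2. Qed.

(* Removing the edges inside irregular pairs, sparse pairs or small cells
   leaves no triangle unless a regular dense triple of large cells occurs. *)
Lemma triangle_removal (R : archiRealFieldType) (eps : R) :
  0 < eps ->
  exists2 delta : R, 0 < delta & forall (V : finType) (G : rel V),
    (exists2 Bad : {set V * V}, #|Bad|%:R <= eps * #|V|%:R ^+ 2 &
       forall u v w, G u v -> G v w -> G u w ->
         [|| (u, v) \in Bad, (v, w) \in Bad | (u, w) \in Bad])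
    \/ delta * #|V|%:R ^+ 3 <=
         \sum_u \sum_v \sum_w [&& G u v, G v w & G u w]%:R.
Proof.
move=> e0.
(* [Bad] collects four kinds of pairs, each allowed a share [eps / 4]: [d] serves the sparse ones,
   [er] the irregular ones, and [c] the two kinds with an end in a small cell. Moreover
   [d ^+ 3 - 2 * er] is half of [d ^+ 3]. *)
pose d := Num.min 1 (eps / 4).
have d0 : 0 < d by rewrite lt_min ltr01 divr_gt0.
have d1 : d <= 1 by rewrite ge_min lexx.
have de : d <= eps / 4 by rewrite ge_min lexx orbT.
pose er := d ^+ 3 / 4.
have er0 : 0 < er by rewrite divr_gt0 // exprn_gt0.
have er1 : er <= eps / 4.
  have : d ^+ 3 <= d by rewrite -[leRHS]expr1 ler_wiXn2l // ltW.
  by rewrite /er; lra.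
have [M HM] := regularity er0.
pose c := eps / (4 * M.+1%:R).
have c0 : 0 < c by rewrite divr_gt0 // mulr_gt0.
exists ((d ^+ 3 / 2) * c ^+ 3).
  by rewrite mulr_gt0 ?divr_gt0 ?exprn_gt0.
move=> V G; have [T [p [TM reg]]] := HM V G.
set N : R := #|V|%:R; have N0 : 0 <= N by exact: ler0n.
pose low := fun l => dens (pair_label p) (ind R G) l < d.
pose small := fun x => cell_size R p (p x) < c * N.
pose Bad := [set w : V * V | [|| irregular G p er (pair_label p w),
  low (pair_label p w) && G w.1 w.2, small w.1 | small w.2]].
case: (boolP [forall u, forall v, forall w, [&& G u v, G v w & G u w] ==>
   [|| (u, v) \in Bad, (v, w) \in Bad | (u, w) \in Bad]]) => [/forallP H|].
  left; exists Bad; last first.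
    move=> u v w Guv Gvw Guw.
    by have /forallP/(_ v)/forallP/(_ w) := H u; rewrite Guv Gvw Guw.
  have b1 : \sum_(w | irregular G p er (pair_label p w)) 1 <= eps / 4 * N ^+ 2.
    by rewrite (le_trans reg) // sum1_pair ler_wpM2r // sqr_ge0.
  (* By [sum_dens], the edges in sparse cells are counted by the densities of these cells, each
     below [d]. *)
  have b2 : \sum_w (low (pair_label p w) && G w.1 w.2)%:R <= eps / 4 * N ^+ 2.
    have -> : \sum_w (low (pair_label p w) && G w.1 w.2)%:R =
       \sum_w ind R G w * (low (pair_label p w))%:R.
      by apply: eq_bigr => w _; rewrite /ind -natrM mulnb andbC.
    rewrite -(sum_dens _ _ (fun l => (low l)%:R)).
    rewrite -sum1_pair mulr_sumr; apply: ler_sum => w _.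
    case: (boolP (low _)) => [lw|_]; last by rewrite mulr0 mulr1 divr_ge0 // ltW.
    by rewrite !mulr1 (le_trans (ltW lw)).
  have b3 : \sum_(x | small x) 1 <= eps / 4 * N.
    apply: le_trans (sum_small_cells p (mulr_ge0 (ltW c0) N0)) _.
    rewrite mulrA ler_wpM2r // /c.
    have : #|T|%:R <= M.+1%:R :> R by rewrite ler_nat leqW.
    have : 0 < M.+1%:R :> R by [].
    move: (#|T|%:R) (M.+1%:R) => x y y0 xy.
    rewrite mulrA ler_pdivrMr ?mulr_gt0 //.
    have : x * eps <= y * eps by rewrite ler_wpM2r // ltW.
    nra.
  have b4 : \sum_(x : V) \sum_(y : V) (small x)%:R <= eps / 4 * N ^+ 2.
    rewrite expr2 mulrA; apply: le_trans (ler_wpM2r N0 b3).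
    rewrite [in leRHS]big_mkcond /= mulr_suml; apply: ler_sum => x _.
    by rewrite sumr_const -[_ *+ #|_|]mulr_natr; case: (small x); rewrite ?mul0r.
  have b5 : \sum_(x : V) \sum_(y : V) (small y)%:R <= eps / 4 * N ^+ 2.
    by rewrite exchange_big.
  rewrite (pair_bigA _ (fun x y : V => (small x)%:R)) /= in b4.
  rewrite (pair_bigA _ (fun x y : V => (small y)%:R)) /= in b5.
  apply: le_trans (_ : \sum_(w : V * V)
     ((irregular G p er (pair_label p w))%:R
      + (low (pair_label p w) && G w.1 w.2)%:R
      + (small w.1)%:R + (small w.2)%:R) <= _).
    rewrite -sum1_card natr_sum [leLHS]big_mkcond; apply: ler_sum => w _.
    rewrite inE.
    case: (irregular _ _ _ _); case: (_ && _); case: (small _); case: (small _);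
      rewrite /= ?addr0 ?add0r //; lra.
  have -> : eps * N ^+ 2 = eps / 4 * N ^+ 2 + eps / 4 * N ^+ 2
      + eps / 4 * N ^+ 2 + eps / 4 * N ^+ 2 by field.
  rewrite !big_split /=; do 3!apply: lerD => //.
  apply: le_trans b1; rewrite [leRHS]big_mkcond /=.
  by apply: ler_sum => w _; case: (irregular _ _ _ _).
(* A triangle avoiding [Bad] lies over three large cells whose pairs are dense and regular; the
   triangles over these cells suffice. *)
move=> /forallPn[u /forallPn[v /forallPn[w]]].
rewrite negb_imply => /andP[/and3P[Guv Gvw Guw]].
rewrite !inE !Guv !Gvw !Guw !andbT /= !negb_or -!leNgt.
case/and3P=> /and4P[iuv luv su sv] /and4P[ivw lvw _ sw] /and4P[_ luw _ _].
right.
have := triangle_counting (ltW er0) _ iuv ivw luv lvw luw.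
rewrite d1 (ltW d0) => /(_ isT) cnt.
apply: le_trans (le_trans cnt _).
  have -> : d ^+ 3 - 2 * er = d ^+ 3 / 2 by rewrite /er; field.
  rewrite -[leLHS]mulrA -exprMn /=; apply: ler_wpM2l.
    by rewrite divr_ge0 ?exprn_ge0 ?ltW.
  have cN0 : 0 <= c * N by rewrite mulr_ge0 // ltW.
  rewrite exprS expr2 mulrA; apply: ler_pM => //; first exact: mulr_ge0.
  exact: ler_pM.
rewrite big_mkcond; apply: ler_sum => x _.
case: eqP => _; last by rewrite !sumr_ge0 // => y _; apply: sumr_ge0.
rewrite big_mkcond; apply: ler_sum => y _.
case: eqP => _; last by rewrite sumr_ge0.
by rewrite big_mkcond; apply: ler_sum => z _; case: eqP.
Qed.

(** * Removal for Schur triples *)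

(** The guard keeps sums beyond [n] out of [F], as [inord] would send them to 0. *)
Definition nmem (n : nat) (F : {set 'I_n.+1}) (m : nat) : bool :=
  (m < n.+1)%N && (inord m \in F).

Lemma nmem_val (n : nat) (F : {set 'I_n.+1}) (x : 'I_n.+1) :
  nmem F x = (x \in F).
Proof. by rewrite /nmem ltn_ord inord_val. Qed.

Definition schur_pairs (n : nat) (F : {set 'I_n.+1}) :
    {set 'I_n.+1 * 'I_n.+1} :=
  [set w | [&& w.1 \in F, w.2 \in F & nmem F (w.1 + w.2)]].

(** Differences are taken without wrap-around; an edge that starts at most at [2 * n] with a label
    at most [n] ends within the vertex set. *)
Definition diff_graph (n : nat) (F : {set 'I_n.+1}) : rel 'I_(3 * n).+1 :=
  fun u v => (u <= v)%N && nmem F (v - u).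

Lemma diff_graph_edge (n : nat) (F : {set 'I_n.+1}) (u v : nat) (y : 'I_n.+1) :
  (v <= 3 * n)%N -> (u + y = v)%N -> y \in F ->
  diff_graph F (inord u) (inord v).
Proof.
move=> vn uyv yF; rewrite /diff_graph -uyv !inordK; try lia.
by rewrite leq_addr addKn nmem_val yF.
Qed.

(** Given [u], a triangle is determined by the Schur pair [(v - u, w - v)], whose sum is [w - u]. *)
Lemma diff_graph_triangles (n : nat) (F : {set 'I_n.+1}) :
  (\sum_u \sum_v \sum_w
     [&& diff_graph F u v, diff_graph F v w & diff_graph F u w]
   <= (3 * n).+1 * #|schur_pairs F|)%N.
Proof.
apply: leq_trans (_ : \sum_(u < (3 * n).+1) #|schur_pairs F| <= _)%N; last first.
  by rewrite sum_nat_const card_ord.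
apply: leq_sum => u _.
rewrite pair_bigA /=.
pose S := [set vw : 'I_(3 * n).+1 * 'I_(3 * n).+1 |
  [&& diff_graph F u vw.1, diff_graph F vw.1 vw.2 & diff_graph F u vw.2]].
have -> : (\sum_(vw : 'I_(3 * n).+1 * 'I_(3 * n).+1)
   [&& diff_graph F u vw.1, diff_graph F vw.1 vw.2 & diff_graph F u vw.2]
   = #|S|)%N.
  rewrite -sum1_card big_mkcond [RHS]big_mkcond /=; apply: eq_bigr => w _.
  by rewrite inE; case: (_ && _).
pose f (vw : 'I_(3 * n).+1 * 'I_(3 * n).+1) : 'I_n.+1 * 'I_n.+1 :=
  (inord (vw.1 - u), inord (vw.2 - vw.1)).
have fin : {in S &, injective f}.
  move=> [v w] [v' w']; rewrite !inE /= => /and3P[/andP[uv /andP[k1 _]]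
    /andP[vw /andP[k2 _]] _] /and3P[/andP[uv' /andP[k1' _]]
    /andP[vw' /andP[k2' _]] _] [].
  move=> /(congr1 val) /=; rewrite !inordK // => e1.
  move=> /(congr1 val) /=; rewrite !inordK // => e2.
  by congr (_, _); apply: val_inj => /=; lia.
rewrite -(card_in_imset fin) subset_leq_card //.
apply/subsetP => _ /imsetP[[v w] + ->]; rewrite !inE /=.
move=> /and3P[/andP[uv /andP[k1 k1F]] /andP[vw /andP[k2 k2F]] /andP[uw k3]].
rewrite k1F k2F /= !inordK //.
by have -> : (v - u + (w - v) = w - u)%N by lia.
Qed.

(** An element that labels many bad edges is deleted. If the survivors had [s + t = z], each of the
    [n + 1] starts [x] would give a triangle [x], [x + s], [x + z], and the bad edges would be too
    few to meet all of them. Distinct labels have distinct edges, so few elements are deleted. *)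
Lemma schur_removal (R : archiRealFieldType) (eps : R) :
  0 < eps ->
  exists2 delta : R, 0 < delta & forall (n : nat) (F : {set 'I_n.+1}),
    (exists2 B : {set 'I_n.+1}, B \subset F &
       sum_free B /\ #|F :\: B|%:R <= eps * n.+1%:R)
    \/ delta * n.+1%:R ^+ 2 <= #|schur_pairs F|%:R.
Proof.
move=> e0.
(* Of the factor 27, 9 comes from [(3 * n).+1] squared and 3 from the threshold in [B]. *)
have [d d0 rem] := triangle_removal (divr_gt0 e0 (ltr0n _ 27) : 0 < eps / 27).
exists (d / 3); first exact: divr_gt0.
move=> n F; case: (rem _ (diff_graph F)) => [[Bad BadC BadT]|tri]; last first.
  right; have := diff_graph_triangles F.
  rewrite -(ler_nat R) natrM !natr_sum.
  set s := \sum_(_ | _) _; have -> : s = \sum_u \sum_v \sum_w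
     [&& diff_graph F u v, diff_graph F v w & diff_graph F u w]%:R.
    apply: eq_bigr => u _; rewrite natr_sum; apply: eq_bigr => v _.
    by rewrite natr_sum.
  move=> tri2; have := le_trans tri tri2; rewrite card_ord.
  have n3 : (3 * n).+1%:R <= 3 * n.+1%:R :> R by rewrite -natrM ler_nat; lia.
  have n1 : n.+1%:R <= (3 * n).+1%:R :> R by rewrite ler_nat; lia.
  have np : 0 < n.+1%:R :> R by [].
  move: n3 n1 np; set N := n.+1%:R; set K := (3 * n).+1%:R; set c := #|_|%:R.
  move=> n3 n1 np.
  have Kp : 0 < K by apply: lt_le_trans n1.
  rewrite exprS mulrCA ler_pM2l // => h.
  have : d * N ^+ 2 <= d * K ^+ 2.
    apply: ler_wpM2l; first exact: ltW.
    by rewrite !expr2; apply: ler_pM => //; exact: ltW.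
  have : 0 <= d * N ^+ 2 by rewrite mulr_ge0 ?sqr_ge0 // ltW.
  lra.
left.
pose bad (x s : nat) : bool :=
  ((inord x : 'I_(3 * n).+1), (inord (x + s) : 'I_(3 * n).+1)) \in Bad.
pose badset (s : nat) := [set x : 'I_(2 * n).+1 | bad x s].
pose B := [set s in F | (3 * #|badset s| < n.+1)%N].
exists B; first by apply/subsetP => s; rewrite inE => /andP[].
split.
  (* The middle edge of the triangle starts at [s + x]; this shift is why [badset] ranges up to
     [2 * n]. *)
  have off (o s : nat) : (o <= n)%N ->
      (#|[set x : 'I_n.+1 | bad (o + x) s]| <= #|badset s|)%N.
    move=> on; pose f (x : 'I_n.+1) : 'I_(2 * n).+1 := inord (o + x).
    have fE x : val (f x) = (o + x)%N by rewrite /= inordK //; have := ltn_ord x; lia.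
    rewrite -(@card_imset _ _ f); last first.
      by move=> x y /(congr1 val); rewrite !fE => h; apply: val_inj => /=; lia.
    apply/subset_leq_card/subsetP => _ /imsetP[x + ->].
    by rewrite !inE fE.
  apply/forallP => s; apply/implyP; rewrite inE => /andP[sF sb].
  apply/forallP => t; apply/implyP; rewrite inE => /andP[tF tb].
  apply/forallP => z; apply/implyP; rewrite inE => /andP[zF zb].
  apply/negP => /eqP stz.
  pose X1 := [set x : 'I_n.+1 | bad (0 + x)%N s].
  pose X2 := [set x : 'I_n.+1 | bad (s + x)%N t].
  pose X3 := [set x : 'I_n.+1 | bad (0 + x)%N z].
  have sn := ltn_ord s; have tn := ltn_ord t; have zn := ltn_ord z.
  have : (#|X1 :|: X2 :|: X3| < #|'I_n.+1|)%N.
    rewrite card_ord.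
    have u1 : (#|X1 :|: X2 :|: X3| <= #|X1 :|: X2| + #|X3|)%N.
      exact: (leq_card_setU _ _).1.
    have u2 : (#|X1 :|: X2| <= #|X1| + #|X2|)%N by exact: (leq_card_setU _ _).1.
    have o1 : (#|X1| <= #|badset s|)%N by exact: (off 0%N s isT).
    have o2 : (#|X2| <= #|badset t|)%N by exact: (off s t sn).
    have o3 : (#|X3| <= #|badset z|)%N by exact: (off 0%N z isT).
    lia.
  move=> small.
  have [x] : exists x, x \notin X1 :|: X2 :|: X3.
    apply/existsP; rewrite -[X in is_true X]negbK.
    apply/negP => /existsPn all; move: small.
    rewrite (_ : _ :|: _ = setT) ?cardsT ?ltnn //.
    by apply/setP => x; rewrite [RHS]inE; apply/negPn/all.
  have xn := ltn_ord x.
  rewrite !inE !negb_or !add0n => /andP[/andP[x1 x2] x3].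
  have [l1 l2] : (s + x <= 3 * n)%N /\ (x + z <= 3 * n)%N.
    by clear -sn xn zn; split; lia.
  have l3 : (s + x + t = x + z)%N by rewrite -stz -addnA addnCA.
  have e1 := diff_graph_edge l1 (addnC x s) sF.
  have e2 := diff_graph_edge l2 l3 tF.
  have e3 := diff_graph_edge l2 (erefl (x + z)%N) zF.
  have := BadT _ _ _ e1 e2 e3; move: x1 x2 x3; rewrite /bad l3.
  by rewrite [(s + x)%N]addnC => /negbTE -> /negbTE -> /negbTE ->.
pose S := [set w : 'I_n.+1 * 'I_(2 * n).+1 |
  (w.1 \in F :\: B) && (w.2 \in badset w.1)].
have SE : (#|S| = \sum_(s in F :\: B) #|badset s|)%N.
  under [RHS]eq_bigr do rewrite -sum1_card.
  rewrite pair_big_dep -sum1_card; apply: eq_bigl => w; by rewrite inE.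
have S1 : (#|F :\: B| * n.+1 <= 3 * #|S|)%N.
  rewrite SE big_distrr /= -sum_nat_const; apply: leq_sum => s.
  by rewrite !inE => /andP[+ sF]; rewrite sF /= -leqNgt.
have S2 : (#|S| <= #|Bad|)%N.
  pose f (w : 'I_n.+1 * 'I_(2 * n).+1) : 'I_(3 * n).+1 * 'I_(3 * n).+1 :=
    (inord w.2, inord (w.2 + w.1)).
  rewrite -(@card_imset _ _ f).
    apply/subset_leq_card/subsetP => _ /imsetP[w + ->].
    by rewrite !inE => /andP[_].
  move=> [s x] [s' x'] [] /(congr1 val) /= + /(congr1 val) /=.
  have := ltn_ord s; have := ltn_ord s'; have := ltn_ord x; have := ltn_ord x'.
  move=> h1 h2 h3 h4; rewrite !inordK; try lia.
  by move=> e1 e2; congr (_, _); apply: val_inj => /=; lia.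
have : (#|F :\: B| * n.+1)%:R <= 3 * #|Bad|%:R :> R.
  by rewrite -natrM ler_nat; apply: leq_trans S1 _; rewrite leq_mul2l S2.
rewrite natrM; move: BadC; rewrite card_ord.
have n3 : (3 * n).+1%:R <= 3 * n.+1%:R :> R by rewrite -natrM ler_nat; lia.
have np : 0 < n.+1%:R :> R by [].
have Kp : 0 <= (3 * n).+1%:R :> R by [].
move: np n3 Kp; set N := n.+1%:R; set K := (3 * n).+1%:R.
move=> np n3 Kp h1 h2; rewrite -(ler_pM2r np).
have : eps / 27 * K ^+ 2 <= eps / 27 * (3 * N) ^+ 2.
  apply: ler_wpM2l; first by rewrite divr_ge0 // ltW.
  by rewrite !expr2; apply: ler_pM.
have -> : eps / 27 * (3 * N) ^+ 2 = eps * N * N / 3 by field.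
lra.
Qed.

(** * Containers for sum-free sets *)

Definition schur_degree (n : nat) (F : {set 'I_n.+1}) (x : 'I_n.+1) : nat :=
  #|[set y in F | nmem F (x + y)]|.

Lemma card_schur_pairs (n : nat) (F : {set 'I_n.+1}) :
  (#|schur_pairs F| = \sum_(x in F) schur_degree F x)%N.
Proof.
rewrite /schur_degree; under [RHS]eq_bigr do rewrite -sum1_card.
by rewrite pair_big_dep -sum1_card; apply: eq_bigl => w; rewrite !inE.
Qed.

(* As the difference of the end points determines the label, the links of
   distinct elements of [T] are edge-disjoint. *)
Definition link (n : nat) (F T : {set 'I_n.+1}) (y : 'I_n.+1) :
    {set 'I_n.+1} :=
  [set z in F | [exists t in T, (y + t == z)%N || (z + t == y)%N]].

Definition links (n : nat) (F T U : {set 'I_n.+1}) : {set 'I_n.+1} :=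
  \bigcup_(u in U) link F T u.

(** The container determined by [T] and [U], in the graph with neighbourhoods [link F T]. *)
Definition sparse_part (n : nat) (F T U : {set 'I_n.+1}) (b : nat) :
    {set 'I_n.+1} :=
  [set v in F :\: links F T U | (#|link F T v :\: links F T U| < b)%N].

(** The left-hand side counts edges. At most [2 * #|T|] of them meet a given vertex outside the
    sparse part; the remaining ones lie inside it, where each vertex has fewer than [b] neighbours
    off [links F T U]. *)
Lemma sparse_part_card (n : nat) (F T U : {set 'I_n.+1}) (b : nat) :
  (\sum_(t in T) schur_degree F t
    <= 2 * #|T| * #|F :\: sparse_part F T U b| + n.+1 * b)%N.
Proof.
set F' := sparse_part F T U b; set NU := links F T U.
pose E := [set w : 'I_n.+1 * 'I_n.+1 |
  [&& w.1 \in F, w.2 \in F & [exists t in T, (w.1 + t == w.2)%N]]].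
have lower : (\sum_(t in T) schur_degree F t <= #|E|)%N.
  rewrite /schur_degree; under eq_bigr do rewrite -sum1_card.
  rewrite pair_big_dep /=.
  pose E0 := [set w : 'I_n.+1 * 'I_n.+1 |
    (w.1 \in T) && (w.2 \in [set y in F | nmem F (w.1 + y)])].
  have -> : (\sum_(w | (w.1 \in T) && (w.2 \in [set y in F | nmem F (w.1 + y)])) 1
     = #|E0|)%N by rewrite -sum1_card; apply: eq_bigl => w; rewrite [RHS]inE.
  pose f (w : 'I_n.+1 * 'I_n.+1) : 'I_n.+1 * 'I_n.+1 :=
    (w.2, inord (w.1 + w.2)).
  rewrite -(@card_in_imset _ _ f).
    apply/subset_leq_card/subsetP => _ /imsetP[[t y] + ->].
    rewrite !inE /= => /and3P[tT yF /andP[k kF]]; rewrite yF kF /=.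
    by apply/existsP; exists t; rewrite tT inordK // addnC eqxx.
  move=> [t y] [t' y']; rewrite !inE /= => /and3P[_ _ /andP[k _]].
  move=> /and3P[_ _ /andP[k' _]] [yy /(congr1 val) /=].
  rewrite -yy in k' *; rewrite !inordK // => e.
  by congr (_, _); apply: val_inj => /=; lia.
apply: leq_trans lower _.
pose Z := F :\: F'.
pose E1 := [set w in E | w.1 \in Z].
pose E2 := [set w in E | w.2 \in Z].
pose E3 := [set w : 'I_n.+1 * 'I_n.+1 |
  (w.1 \in F') && (w.2 \in link F T w.1 :\: NU)].
have c1 : (#|E1| <= #|Z| * #|T|)%N.
  rewrite -cardsX.
  pose f (w : 'I_n.+1 * 'I_n.+1) : 'I_n.+1 * 'I_n.+1 :=
    (w.1, inord (w.2 - w.1)).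
  rewrite -(@card_in_imset _ _ f).
    apply/subset_leq_card/subsetP => _ /imsetP[[y z] + ->].
    rewrite inE => /andP[]; rewrite inE /= => /and3P[_ _ /existsP[t]].
    case/andP=> tT /eqP yz yZ; rewrite inE /= yZ /=.
    by rewrite -yz addnC addnK inord_val.
  move=> [y z] [y' z']; rewrite ![_ \in E1]inE => /andP[+ _] /andP[+ _].
  rewrite !inE /= => /and3P[_ _ /existsP[t /andP[_ /eqP yz]]].
  move=> /and3P[_ _ /existsP[t' /andP[_ /eqP yz']]] [yy /(congr1 val) /=].
  rewrite -yy in yz' *; have := ltn_ord z; have := ltn_ord z' => hz hz'.
  rewrite !inordK; try lia.
  by move=> e; congr (_, _); apply: val_inj => /=; lia.
have c2 : (#|E2| <= #|Z| * #|T|)%N.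
  rewrite -cardsX.
  pose f (w : 'I_n.+1 * 'I_n.+1) : 'I_n.+1 * 'I_n.+1 :=
    (w.2, inord (w.2 - w.1)).
  rewrite -(@card_in_imset _ _ f).
    apply/subset_leq_card/subsetP => _ /imsetP[[y z] + ->].
    rewrite inE => /andP[]; rewrite inE /= => /and3P[_ _ /existsP[t]].
    case/andP=> tT /eqP yz yZ; rewrite inE /= yZ /=.
    by rewrite -yz addnC addnK inord_val.
  move=> [y z] [y' z']; rewrite ![_ \in E2]inE => /andP[+ _] /andP[+ _].
  rewrite !inE /= => /and3P[_ _ /existsP[t /andP[_ /eqP yz]]].
  move=> /and3P[_ _ /existsP[t' /andP[_ /eqP yz']]] [+ /(congr1 val) /=].
  move=> zz; rewrite -zz in yz' *; have hz := ltn_ord z.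
  rewrite !inordK; try lia.
  by move=> e; congr (_, _); apply: val_inj => /=; lia.
have c3 : (#|E3| <= n.+1 * b)%N.
  have -> : (#|E3| = \sum_(y in F') #|link F T y :\: NU|)%N.
    under [RHS]eq_bigr do rewrite -sum1_card.
    by rewrite pair_big_dep -sum1_card; apply: eq_bigl => w; rewrite inE.
  apply: leq_trans (_ : \sum_(y in F') b <= _)%N.
    by apply: leq_sum => y; rewrite inE => /andP[_ /ltnW].
  rewrite sum_nat_const leq_mul2r; apply/orP; right.
  by rewrite -[leqRHS](card_ord n.+1) max_card.
have sub : E \subset E1 :|: E2 :|: E3.
  apply/subsetP => w wE; rewrite !in_setU [w \in E1]inE [w \in E2]inE wE /=.
  move: wE; rewrite inE => /and3P[w1 w2 /existsP[t /andP[tT wt]]].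
  rewrite [w.1 \in Z]inE [w.2 \in Z]inE w1 w2 !andbT.
  case: (boolP (w.1 \in F')) => //= w1'; case: (boolP (w.2 \in F')) => //= w2'.
  rewrite inE w1' /= inE.
  move: w2'; rewrite inE => /andP[+ _]; rewrite inE => /andP[-> _] /=.
  by rewrite inE w2; apply/existsP; exists t; rewrite tT wt.
have := subset_leq_card sub.
have u1 : (#|E1 :|: E2 :|: E3| <= #|E1 :|: E2| + #|E3|)%N.
  exact: (leq_card_setU _ _).1.
have u2 : (#|E1 :|: E2| <= #|E1| + #|E2|)%N by exact: (leq_card_setU _ _).1.
rewrite -/Z; lia.
Qed.

Lemma sum_freeP (n : nat) (S : {set 'I_n.+1}) :
  reflect (forall x y z, x \in S -> y \in S -> z \in S -> (x + y <> z)%N)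
    (sum_free S).
Proof.
apply: (iffP idP) => [H x y z xS yS zS|H].
  move: H => /forallP/(_ x); rewrite xS => /forallP/(_ y); rewrite yS.
  by move=> /forallP/(_ z); rewrite zS => /eqP.
apply/forallP => x; apply/implyP => xS; apply/forallP => y; apply/implyP => yS.
by apply/forallP => z; apply/implyP => zS; apply/eqP/H.
Qed.

(** As [S] is sum-free and contains [T], it is independent in the graph and avoids the neighbourhood
    of [U]. Take [U] largest among the subsets of [S] with at least [b] neighbours per element on
    average: a vertex of [S] with [b] new neighbours could be added to it. *)
Lemma sparse_part_cover (n : nat) (F T S : {set 'I_n.+1}) (b : nat) :
  (0 < b)%N -> S \subset F -> T \subset S -> sum_free S ->
  exists2 U : {set 'I_n.+1}, (#|U| * b <= n.+1)%N & S \subset sparse_part F T U b.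
Proof.
move=> b0 SF TS /sum_freeP sf.
pose P (U : {set 'I_n.+1}) := (U \subset S) && (#|U| * b <= #|links F T U|)%N.
have P0 : P set0 by rewrite /P sub0set cards0 mul0n.
case: (@arg_maxnP _ set0 P (fun U : {set 'I_n.+1} => #|U|) P0) => U /andP[US Ub] Umax.
exists U; first by rewrite (leq_trans Ub) // -[leqRHS](card_ord n.+1) max_card.
apply/subsetP => v vS; rewrite inE inE (subsetP SF) // andbT.
apply/andP; split.
  apply/bigcupP => -[u uU]; rewrite inE => /andP[_ /existsP[t /andP[tT]]].
  have uS := subsetP US _ uU; have tS := subsetP TS _ tT.
  by case/orP => /eqP; apply: sf.
case: (boolP (v \in U)) => vU.
  rewrite (_ : _ :\: _ = set0) ?cards0 //; apply/eqP; rewrite setD_eq0.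
  exact: (bigcup_sup v).
rewrite ltnNge; apply/negP => big.
have := Umax (v |: U); rewrite cardsU1 vU /= add1n ltnn => H.
suff: false by []. apply: H.
rewrite /P subUset sub1set vS US /= cardsU1 vU add1n mulSn.
rewrite /links bigcup_setU big_set1 -/(links F T U).
apply: leq_trans (leq_add big Ub) _.
rewrite -(leq_add2r #|link F T v :&: links F T U|) cardsUI.
by rewrite -(cardsID (links F T U) (link F T v)) addnC addnA.
Qed.

Definition small_sets (R : realFieldType) (n : nat) (tau : R) :
    {set {set 'I_n.+1}} :=
  [set U : {set 'I_n.+1} | #|U|%:R <= tau * n.+1%:R].

(** If [S] has fewer than [k] elements in the set [D] of high degrees, the container is [F] without
    [D], plus these elements; otherwise it is the sparse part for some [T] of [k] elements of
    [S :&: D]. Both cases shrink [F] linearly. *)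
Lemma container_step (R : archiRealFieldType) (delta tau : R) :
  0 < delta -> 0 < tau ->
  exists n0 : nat, forall n (F : {set 'I_n.+1}), (n0 <= n)%N ->
    delta * n.+1%:R ^+ 2 <= #|schur_pairs F|%:R ->
    exists C : {set {set 'I_n.+1}},
      [/\ (#|C| <= #|small_sets n tau| ^ 2)%N,
          forall K, K \in C -> #|K|%:R <= #|F|%:R - delta / 8 * n.+1%:R
        & forall S : {set 'I_n.+1}, S \subset F -> sum_free S ->
            exists2 K, K \in C & S \subset K].
Proof.
move=> d0 t0.
(* [b] makes [U] small, since [#|U| * b <= n.+1]; [k] makes the term [n.+1 * b] of
   [sparse_part_card] at most half of the lower bound on the edges; [n1] and [n2] bring [k] below
   [tau * n.+1] and [delta / 8 * n.+1]. *)
pose b := (Num.bound tau^-1).+1.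
have bt : 1 <= b%:R * tau.
  rewrite -ler_pdivrMr // mul1r; apply: le_trans (_ : (Num.bound tau^-1)%:R <= _).
    by apply/ltW/archi_boundP; rewrite invr_ge0 ltW.
  by rewrite ler_nat.
pose k := (Num.bound (4 * b%:R / delta)).+1.
have kd : 4 * b%:R <= k%:R * delta.
  rewrite -ler_pdivrMr //.
  apply: le_trans (_ : (Num.bound (4 * b%:R / delta))%:R <= _).
    by apply/ltW/archi_boundP; rewrite divr_ge0 ?mulr_ge0 // ltW.
  by rewrite ler_nat.
pose n1 := Num.bound (k%:R / tau).
pose n2 := Num.bound (k%:R / (delta / 8)).
exists (maxn n1 n2) => n F; rewrite geq_max => /andP[n1n n2n] many.
set N : R := n.+1%:R; have N0 : 0 < N by [].
have kt : k%:R <= tau * N.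
  rewrite mulrC -ler_pdivrMr //; apply: le_trans (_ : n1%:R <= _).
    by apply/ltW/archi_boundP; rewrite divr_ge0 // ltW.
  by rewrite ler_nat ltnW.
have kN : k%:R <= delta / 8 * N.
  rewrite mulrC -ler_pdivrMr ?divr_gt0 //; apply: le_trans (_ : n2%:R <= _).
    by apply/ltW/archi_boundP; rewrite divr_ge0 ?divr_ge0 // ltW.
  by rewrite ler_nat ltnW.
pose D := [set x in F | delta / 2 * N <= (schur_degree F x)%:R].
have DF : D \subset F by apply/subsetP => x; rewrite inE => /andP[].
have FN (A : {set 'I_n.+1}) : #|A|%:R <= N.
  by rewrite ler_nat -[leqRHS](card_ord n.+1) max_card.
(* Averaging: an element of [D] has degree at most [N], any other at most [delta / 2 * N]. *)
have Dbig : delta / 2 * N <= #|D|%:R.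
  have : delta * N ^+ 2 <= \sum_(x in F) ((x \in D)%:R * N + delta / 2 * N).
    apply: le_trans many _; rewrite card_schur_pairs natr_sum.
    apply: ler_sum => x xF; rewrite inE xF /=.
    case: (leP (delta / 2 * N)) => h; last by rewrite mul0r add0r ltW.
    rewrite mul1r; apply: le_trans (FN _) _; rewrite lerDl.
    by rewrite mulr_ge0 ?divr_ge0 // ltW.
  rewrite big_split /= -mulr_suml sumr_const.
  have -> : \sum_(x in F) (x \in D)%:R = #|D|%:R :> R.
    rewrite -sum1_card natr_sum big_mkcond [RHS]big_mkcond /=.
    by apply: eq_bigr => x _; case: (boolP (x \in D)) => [/(subsetP DF) ->|]; case: (x \in F).
  rewrite -[_ *+ _]mulr_natr.
  have : delta / 2 * N * #|F|%:R <= delta / 2 * N * N.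
    by apply: ler_wpM2l (FN F); rewrite mulr_ge0 ?divr_ge0 // ltW.
  have -> : delta * N ^+ 2 = delta * N * N by ring.
  move=> h1 h2; rewrite -(ler_pM2r N0); lra.
(* The size of the first set tells the two cases apart, so the pair alone determines the
   container. *)
pose cont (X : {set 'I_n.+1} * {set 'I_n.+1}) :=
  if (#|X.1| < k)%N then (F :\: D) :|: X.1 else sparse_part F X.1 X.2 b.
pose ok (X : {set 'I_n.+1} * {set 'I_n.+1}) :=
  [&& X \in setX (small_sets n tau) (small_sets n tau), X.1 \subset D
    & (#|X.1| <= k)%N].
exists (cont @: [set X | ok X]); split.
- apply: leq_trans (leq_imset_card _ _) _.
  rewrite expnS expn1 -cardsX subset_leq_card //.
  by apply/subsetP => X; rewrite inE => /and3P[].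
- move=> _ /imsetP[[T U] + ->]; rewrite inE /cont /= => /and3P[_ /= TD Tk].
  have FD : #|F|%:R = #|D|%:R + #|F :\: D|%:R :> R.
    by rewrite -natrD -(cardsID D F) (setIidPr DF).
  case: ltnP => Tk'.
    have : #|F :\: D :|: T|%:R <= #|F :\: D|%:R + #|T|%:R :> R.
      by rewrite -natrD ler_nat; exact: (leq_card_setU _ _).1.
    have : #|T|%:R <= k%:R :> R by rewrite ler_nat ltnW.
    have : 0 <= delta * N by rewrite mulr_ge0 // ltW.
    lra.
  have Tc : #|T| = k by apply/eqP; rewrite eqn_leq Tk.
  have PF : sparse_part F T U b \subset F.
    by apply/subsetP => x; rewrite inE => /andP[+ _]; rewrite inE => /andP[].
  have : k%:R * (delta / 2 * N) <= 2 * k%:R * #|F :\: sparse_part F T U b|%:R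
      + N * b%:R.
    rewrite -!natrM -natrD -{2}Tc.
    apply: le_trans (_ : (\sum_(t in T) schur_degree F t)%:R <= _); last first.
      by rewrite ler_nat sparse_part_card.
    rewrite natr_sum -Tc mulr_natl -sumr_const; apply: ler_sum => t tT.
    by have := subsetP TD _ tT; rewrite inE => /andP[].
  have -> : #|F|%:R = #|sparse_part F T U b|%:R
      + #|F :\: sparse_part F T U b|%:R :> R.
    by rewrite -natrD -(cardsID (sparse_part F T U b) F) (setIidPr PF).
  set z := #|F :\: _|%:R => h.
  have k0 : 0 < k%:R :> R by [].
  have : 4 * b%:R * N <= k%:R * delta * N by rewrite ler_pM2r.
  have : k%:R * (delta / 8 * N) <= k%:R * z -> delta / 8 * N <= z.
    by rewrite ler_pM2l.
  move=> h1 h2.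
  suff : delta / 8 * N <= z by lra.
  by apply: h1; lra.
move=> S SF Ssf.
have small0 : set0 \in small_sets n tau.
  by rewrite inE cards0 mulr_ge0 // ltW.
case: (ltnP #|S :&: D| k) => SD.
  exists (cont (S :&: D, set0)).
    apply: imset_f; rewrite inE /ok /= subsetIr (ltnW SD) inE /= small0 inE !andbT.
    by apply: le_trans kt; rewrite ler_nat ltnW.
  rewrite /cont /= SD; apply/subsetP => x xS.
  by rewrite inE in_setI xS [_ \in _ :\: _]inE (subsetP SF) // andbT orNb.
have [T] : exists T, T \in [set B : {set 'I_n.+1} | B \subset S :&: D & #|B| == k].
  by apply/card_gt0P; rewrite cards_draws bin_gt0.
rewrite inE subsetI => /andP[/andP[TS TD] /eqP Tk].
have [U Ub SU] := @sparse_part_cover n F T S b isT SF TS Ssf.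
exists (cont (T, U)); last by rewrite /cont /= Tk ltnn.
apply: imset_f; rewrite inE /ok /= TD Tk leqnn inE /= !inE Tk kt !andbT /=.
have : #|U|%:R * b%:R <= N by rewrite -natrM ler_nat.
have : N <= N * (b%:R * tau) by rewrite ler_peMr // ltW.
have b0 : 0 < b%:R :> R by [].
move=> h1 h2; rewrite -(ler_pM2r b0); lra.
Qed.

(** Each round removes at least [delta * n.+1] elements, so after [j] rounds nothing is left; a set
    already close to sum-free is kept as its own container. *)
Lemma container_iter (R : archiRealFieldType) (eps delta tau : R) (n j : nat)
    (F : {set 'I_n.+1}) :
  0 < delta -> 0 <= eps -> 0 <= tau ->
  (forall G : {set 'I_n.+1},
    (exists2 B : {set 'I_n.+1}, B \subset G &
       sum_free B /\ #|G :\: B|%:R <= eps * n.+1%:R) \/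
    exists C : {set {set 'I_n.+1}},
      [/\ (#|C| <= #|small_sets n tau| ^ 2)%N,
          forall K, K \in C -> #|K|%:R <= #|G|%:R - delta * n.+1%:R
        & forall S : {set 'I_n.+1}, S \subset G -> sum_free S ->
            exists2 K, K \in C & S \subset K]) ->
  #|F|%:R <= j%:R * delta * n.+1%:R ->
  exists C : {set {set 'I_n.+1}},
    [/\ (#|C| <= (#|small_sets n tau| ^ 2) ^ j)%N,
        forall K, K \in C -> exists2 B : {set 'I_n.+1}, B \subset K &
           sum_free B /\ #|K :\: B|%:R <= eps * n.+1%:R
      & forall S : {set 'I_n.+1}, S \subset F -> sum_free S ->
            exists2 K, K \in C & S \subset K].
Proof.
move=> d0 e0 t0 step; elim: j F => [|j IH] F Fj.
  exists [set F]; split; first by rewrite cards1.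
    move=> K /set1P ->; exists F => //.
    have F0 : F = set0.
      apply/eqP; rewrite -cards_eq0 -leqn0 -(ler_nat R).
      by apply: le_trans Fj _; rewrite !mul0r.
    rewrite F0 setDv cards0 mulr_ge0 //; split=> //.
    by apply/sum_freeP => x y z; rewrite inE.
  by move=> S SF _; exists F; rewrite ?set11.
case: (step F) => [[B BF Bsf]|[C [C1 C2 C3]]].
  exists [set F]; split.
  - rewrite cards1 !expn_gt0; apply/orP; left; apply/orP; left.
    by apply/card_gt0P; exists set0; rewrite inE cards0 mulr_ge0.
  - by move=> K /set1P ->; exists B.
  - by move=> S SF _; exists F; rewrite ?set11.
have : forall K : {set 'I_n.+1}, exists C' : {set {set 'I_n.+1}}, K \in C ->
    [/\ (#|C'| <= (#|small_sets n tau| ^ 2) ^ j)%N,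
        forall K, K \in C' -> exists2 B : {set 'I_n.+1}, B \subset K &
           sum_free B /\ #|K :\: B|%:R <= eps * n.+1%:R
      & forall S : {set 'I_n.+1}, S \subset K -> sum_free S ->
          exists2 K, K \in C' & S \subset K].
  move=> K; case: (boolP (K \in C)) => KC; last by exists set0.
  have [|C' HC'] := IH K; last by exists C'.
  by apply: le_trans (C2 _ KC) _; move: Fj; rewrite -natr1; lra.
case/fin_all_exists => f fP.
exists (\bigcup_(K in C) f K); split.
- apply: leq_trans (_ : \sum_(K in C) #|f K| <= _)%N.
    elim/big_rec2: _ => [|K m A _ Am]; first by rewrite cards0.
    by apply: leq_trans (leq_card_setU _ _).1 _; rewrite leq_add2l.
  apply: leq_trans (_ : \sum_(K in C) (#|small_sets n tau| ^ 2) ^ j <= _)%N.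
    by apply: leq_sum => K /fP[].
  by rewrite sum_nat_const [leqRHS]expnS leq_mul2r C1 orbT.
- by move=> K /bigcupP[K' /fP[_ + _]]; apply.
- move=> S SF Ssf; have [K KC SK] := C3 S SF Ssf.
  have [_ _ cov] := fP K KC; have [K' K'K SK'] := cov S SK Ssf.
  by exists K' => //; apply/bigcupP; exists K.
Qed.

(** [J] depends on [eps] alone, so [tau] can be chosen afterwards, small enough to bring the power
    [J] of the number of small sets below any given exponential rate. *)
Lemma container_family (R : archiRealFieldType) (eps : R) :
  0 < eps ->
  exists J : nat, forall tau : R, 0 < tau -> exists n0 : nat,
  forall n, (n0 <= n)%N ->
  exists C : {set {set 'I_n.+1}},
    [/\ (#|C| <= #|small_sets n tau| ^ J)%N,
        forall K, K \in C -> exists2 B : {set 'I_n.+1}, B \subset K &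
           sum_free B /\ #|K :\: B|%:R <= eps * n.+1%:R
      & forall S : {set 'I_n.+1}, sum_free S -> exists2 K, K \in C & S \subset K].
Proof.
move=> e0; have [delta d0 rem] := schur_removal e0.
have d8 : 0 < delta / 8 by rewrite divr_gt0.
pose j := Num.bound (delta / 8)^-1.
(* Each of the [j] rounds costs the square of the number of small sets. *)
exists (2 * j)%N => tau t0; have [n0 step] := container_step d0 t0.
exists n0 => n nn0.
have [||||C [C1 C2 C3]] := @container_iter R eps (delta / 8) tau n j setT d8.
- exact: ltW.
- exact: ltW.
- by move=> G; case: (rem _ G) => [|many]; [left|right; apply: step].
- rewrite cardsT card_ord ler_peMl // -ler_pdivrMr // mul1r.
  by apply/ltW/archi_boundP; rewrite invr_ge0 ltW.
by exists C; split=> [||S]; rewrite ?expnM //; apply: C3; rewrite subsetT.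
Qed.

(** * Counting colourings *)

Lemma powR2E (R : realType) (x : R) : 2 `^ x = expR (x * ln 2).
Proof. by rewrite /powR pnatr_eq0. Qed.

Lemma ln2_gt0 (R : realType) : 0 < ln (2 : R).
Proof. by rewrite ln_gt0 // ltr1n. Qed.

(* Rankin's trick: weight each set [U] by [x ^ (#|U| - tau N)] and sum over
   all sets. *)
Lemma small_sets_card (R : realType) (eta : R) :
  0 < eta ->
  exists2 tau : R, 0 < tau &
    forall n, #|small_sets n tau|%:R <= 2 `^ (eta * n.+1%:R).
Proof.
move=> eta0; have l20 := ln2_gt0 R.
(* [x] controls [(1 + x) ^ N] and [tau] controls [x ^ (- tau N)], each by [2 ^ (eta N / 2)]. The 1
   in the denominator of [tau] keeps it positive when [x = 1]. *)
pose x := Num.min 1 (eta * ln 2 / 2).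
have x0 : 0 < x by rewrite lt_min ltr01 divr_gt0 // mulr_gt0.
have x1 : x <= 1 by rewrite ge_min lexx.
have xe : x <= eta * ln 2 / 2 by rewrite ge_min lexx orbT.
have lx : ln x <= 0 by exact: ln_le0.
pose tau := (eta * ln 2 / 2) / (1 - ln x).
have l1 : 0 < 1 - ln x by lra.
have tau0 : 0 < tau by rewrite !divr_gt0 // mulr_gt0.
have tx : tau * - ln x <= eta * ln 2 / 2.
  have : tau * (1 - ln x) = eta * ln 2 / 2 by rewrite /tau divfK // gt_eqF.
  lra.
exists tau => // n; set N : R := n.+1%:R.
have N0 : 0 < N by [].
apply: le_trans (_ : \sum_(U : {set 'I_n.+1}) x ^+ #|U| * expR (tau * N * - ln x) <= _).
  rewrite -sum1_card natr_sum big_mkcond; apply: ler_sum => U _.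
  case: ifP => [|_]; last by rewrite mulr_ge0 ?exprn_ge0 ?expR_ge0 // ltW.
  rewrite inE -/N => UN.
  have -> : x ^+ #|U| = expR (#|U|%:R * ln x) by rewrite expRM_natl lnK.
  rewrite -expRD -[leLHS]expR0 ler_expR.
  have : (tau * N - #|U|%:R) * ln x <= 0 by rewrite mulr_ge0_le0 // subr_ge0.
  lra.
rewrite -mulr_suml.
have -> : \sum_(U : {set 'I_n.+1}) x ^+ #|U| = (1 + x) ^+ n.+1.
  have := @bigA_distr R 0 1 *%R +%R _ (fun _ : 'I_n.+1 => x) (fun _ => 1).
  rewrite prodr_const card_ord addrC => ->.
  by apply: eq_bigr => U _; rewrite -big_mkcond /= -prodr_const.
apply: le_trans (_ : expR (x * N) * expR (tau * N * - ln x) <= _).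
  rewrite ler_wpM2r ?expR_ge0 // expRM_natr lerXn2r ?nnegrE ?expR_ge0 //.
    by rewrite addr_ge0 // ltW.
  exact: expR_ge1Dx.
rewrite -expRD powR2E ler_expR.
have : N * (x + tau * - ln x) <= N * (eta * ln 2).
  by rewrite ler_pM2l //; lra.
lra.
Qed.

Definition multiplicity (n r : nat) (t : set_tuple n r) (x : 'I_n.+1) : nat :=
  #|[set c | x \in t c]|.

Lemma sum_freeS (n : nat) (S T : {set 'I_n.+1}) :
  S \subset T -> sum_free T -> sum_free S.
Proof.
move=> /subsetP ST /sum_freeP sf; apply/sum_freeP => x y z xS yS zS.
by apply: sf; apply: ST.
Qed.

Lemma colour_classP (n : nat) (A : {set 'I_n.+1}) (r : nat)
    (s : colouring A r) (c : 'I_r) (x : 'I_n.+1) :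
  reflect (exists2 y, val y = x & s y = c) (x \in colour_class s c).
Proof.
apply: (iffP imsetP) => [[y + ->]|[y yx sy]].
  by rewrite inE => /set1P; exists y.
by exists y; rewrite // !inE sy.
Qed.

Lemma card_colourings_within (n : nat) (A : {set 'I_n.+1}) (r : nat)
    (t : set_tuple n r) :
  #|[set s : colouring A r | [forall x, val x \in t (s x)]]|
  = (\prod_(x in A) multiplicity t x)%N.
Proof.
rewrite big_sub.
pose F (x : {x : 'I_n.+1 | x \in A}) := [pred c | val x \in t c].
have -> : (\prod_(x : {x | x \in A}) multiplicity t (val x)
   = foldr muln 1 [seq #|F x| | x : {x | x \in A}])%N.
  rewrite foldrE big_map big_enum /=; apply: eq_bigr => x _.
  by rewrite /multiplicity cardsE.
rewrite -card_family cardsE; apply: eq_card => s.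
by rewrite inE; apply/forallP/familyP => h x; have := h x; rewrite inE.
Qed.

Lemma f_set_ge (n r : nat) (A : {set 'I_n.+1}) (t : set_tuple n r) :
  sum_free_tuple t -> (\prod_(x in A) multiplicity t x <= f_set A r)%N.
Proof.
move=> /forallP tsf; rewrite -card_colourings_within.
apply/subset_leq_card/subsetP => s; rewrite !inE => /forallP st.
apply/forallP => c; have /andP[_] := tsf c; apply: sum_freeS.
by apply/subsetP => x /colour_classP[y <- <-].
Qed.

(** [E_part t J] is the fibre over [J] of the map sending [x] to its set of indices, so [n] times
    [g] is the sum of the logarithms of the multiplicities. *)
Lemma exp_g_tuple (R : realType) (n r : nat) (t : set_tuple n r) :
  (0 < n)%N ->
  2 `^ (g_tuple R t * n%:R) = (\prod_(x in \bigcup_i t i) multiplicity t x)%:R.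
Proof.
move=> n0; have l20 := ln2_gt0 R.
pose I (x : 'I_n.+1) := [set c | x \in t c].
have EI (J : {set 'I_r}) (x : 'I_n.+1) : (x \in E_part t J) = (I x == J).
  rewrite !inE; apply/andP/eqP => [[/bigcupP nx /bigcapP xJ]|<-].
    apply/setP => c; rewrite inE; apply/idP/idP; last exact: xJ.
    by move=> xc; apply/negPn/negP => cJ; apply: nx; exists c; rewrite ?inE.
  split; first by apply/bigcupP => -[c]; rewrite !inE => /negP.
  by apply/bigcapP => c; rewrite inE.
have cup x : (x \in \bigcup_i t i) = (I x != set0).
  apply/bigcupP/set0Pn => [[c _ xc]|[c]]; first by exists c; rewrite inE.
  by rewrite inE; exists c.
have -> : g_tuple R t * n%:R
    = \sum_(x in \bigcup_i t i) log2 (multiplicity t x)%:R.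
  rewrite /g_tuple mulrC mulrA divff ?mul1r ?pnatr_eq0 -?lt0n //.
  rewrite [RHS](partition_big I (fun J => J != set0)) /=; last first.
    by move=> x; rewrite cup.
  apply: eq_bigr => J J0; rewrite -sum1_card natr_sum mulr_suml.
  apply: eq_big => [x|x]; last by rewrite EI mul1r => /eqP <-.
  by rewrite EI cup andbC; case: eqP => // ->; rewrite J0.
rewrite powR2E mulr_suml expR_sum natr_prod; apply: eq_bigr => x.
rewrite cup => Ix; rewrite /log2 divfK ?gt_eqF // lnK // posrE ltr0n.
by rewrite /multiplicity card_gt0.
Qed.

(** Among the [#|C| ^ r] tuples of containers, [K] is one that admits the most colourings; a
    positive count supplies a first tuple to maximise from. *)
Lemma f_set_le_family (n r : nat) (A : {set 'I_n.+1})
    (C : {set {set 'I_n.+1}}) :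
  (forall S : {set 'I_n.+1}, sum_free S -> exists2 K, K \in C & S \subset K) ->
  (0 < f_set A r)%N ->
  exists2 K : set_tuple n r, (forall c, K c \in C) &
    (f_set A r <= #|C| ^ r * \prod_(x in A) multiplicity K x)%N.
Proof.
move=> cov.
pose within (K : set_tuple n r) :=
  [set s : colouring A r | [forall x, val x \in K (s x)]].
have sub (s : colouring A r) : valid s ->
    exists2 K : set_tuple n r, K \in ffun_on (mem C) & s \in within K.
  move=> /forallP sv.
  have /fin_all_exists2[K KC sK] c := cov _ (sv c).
  exists [ffun c => K c]; first by apply/ffun_onP => c; rewrite ffunE.
  rewrite inE; apply/forallP => x; rewrite ffunE; apply: (subsetP (sK _)).
  by apply/colour_classP; exists x.
rewrite /f_set => /card_gt0P[s0]; rewrite inE => /sub[K0 K0C _].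
pose mu (K : set_tuple n r) := (\prod_(x in A) multiplicity K x)%N.
have [K KC Kmax] := @arg_maxnP _ K0 (fun K => K \in ffun_on (mem C)) mu K0C.
exists K; first exact/ffun_onP.
apply: leq_trans (_ : #|\bigcup_(K in ffun_on (mem C)) within K| <= _)%N.
  apply/subset_leq_card/subsetP => s; rewrite inE => /sub[K' K'C sK'].
  by apply/bigcupP; exists K'.
apply: leq_trans (_ : \sum_(K in ffun_on (mem C)) #|within K| <= _)%N.
  elim/big_rec2: _ => [|K' m B _ Bm]; first by rewrite cards0.
  by apply: leq_trans (leq_card_setU _ _).1 _; rewrite leq_add2l.
apply: leq_trans (_ : \sum_(K' in ffun_on (mem C)) mu K <= _)%N.
  by apply: leq_sum => K' K'C; rewrite card_colourings_within; apply: Kmax.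
by rewrite sum_nat_const card_ffun_on card_ord.
Qed.

(** Each container is pruned to its sum-free part within [A]. On [A] the multiplicity changes only
    in the small set [X], where it was at most [r <= 2 ^ r]. *)
Lemma f_set_upper (R : realType) (eps : R) (r : nat) :
  0 < eps ->
  exists n0 : nat, forall n, (n0 <= n)%N -> (0 < n)%N ->
  forall A : {set 'I_n.+1}, A \subset bracket n -> (0 < f_set A r)%N ->
  exists t : set_tuple n r,
    [/\ sum_free_tuple t, \bigcup_i t i \subset A,
        #|A|%:R - eps * n%:R <= #|\bigcup_i t i|%:R
      & (f_set A r)%:R <= 2 `^ ((g_tuple R t + eps) * n%:R)].
Proof.
move=> eps0.
(* Half of [eps] pays for the pruning, through [e1], and half for the choice of containers, through
   [eta]; another factor 2 in each covers [n.+1 <= 2 * n]. In [e1], one [r.+1] is for the number of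
   containers and one for the exponent of [2 ^ r]. *)
pose e1 := eps / (4 * r.+1%:R ^+ 2).
have e10 : 0 < e1 by rewrite divr_gt0 // mulr_gt0 // exprn_gt0.
have [J fam] := container_family e10.
pose eta := eps / (4 * (J * r).+1%:R).
have eta0 : 0 < eta by rewrite divr_gt0 // mulr_gt0.
have [tau tau0 small] := small_sets_card eta0.
have [n0 {}fam] := fam tau tau0.
exists n0 => n n0n n_gt0 A Abr fA.
have [C [C1 C2 C3]] := fam n n0n.
have [K KC fK] := f_set_le_family C3 fA.
have /fin_all_exists2[B BK Bsf] c := C2 _ (KC c).
pose t : set_tuple n r := [ffun c => B c :&: A].
pose A' := \bigcup_i t i.
pose X := A :&: \bigcup_c (K c :\: B c).
set N : R := n.+1%:R; have N0 : 0 < N by [].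
have XN : #|X|%:R <= r%:R * (e1 * N).
  apply: le_trans (_ : (\sum_c #|K c :\: B c|)%:R <= _).
    rewrite ler_nat; apply: leq_trans (subset_leq_card (subsetIr _ _)) _.
    elim/big_rec2: _ => [|c m D _ Dm]; first by rewrite cards0.
    by apply: leq_trans (leq_card_setU _ _).1 _; rewrite leq_add2l.
  rewrite natr_sum; apply: le_trans (_ : \sum_(c < r) e1 * N <= _).
    by apply: ler_sum => c _; case: (Bsf c).
  by rewrite sumr_const card_ord mulr_natl.
have A'A : A' \subset A.
  by apply/bigcupsP => c _; rewrite ffunE subsetIr.
have K0 : (0 < \prod_(x in A) multiplicity K x)%N.
  by move: (leq_trans fA fK); rewrite muln_gt0 => /andP[].
(* A positive product puts every element of [A] in some container, so only elements of [X] can be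
   missing from [A']. *)
have Kpos x : x \in A -> exists c, x \in K c.
  move=> xA; move: K0; rewrite (bigD1 x) //= muln_gt0 => /andP[+ _].
  by rewrite card_gt0 => /set0Pn[c]; rewrite inE; exists c.
have AX x : x \in A -> x \notin X ->
    x \in A' /\ multiplicity K x = multiplicity t x.
  move=> xA; rewrite inE xA /= => xX.
  have KB c : (x \in K c) = (x \in t c).
    rewrite ffunE inE xA andbT; apply/idP/idP => [xK|/(subsetP (BK c)) //].
    apply/negPn/negP => xB; move/negP: xX; apply.
    by apply/bigcupP; exists c; rewrite // inE xB.
  split; last by apply: eq_card => c; rewrite !inE KB.
  by have [c] := Kpos x xA; rewrite KB => xt; apply/bigcupP; exists c.
have A'pos x : x \in A' -> (0 < multiplicity t x)%N.
  by case/bigcupP => c _ xc; rewrite card_gt0; apply/set0Pn; exists c; rewrite inE.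
have prodK : (\prod_(x in A) multiplicity K x
    <= (2 ^ r) ^ #|X| * \prod_(x in A') multiplicity t x)%N.
  have -> : ((2 ^ r) ^ #|X| = \prod_(x in A) if x \in X then 2 ^ r else 1)%N.
    rewrite -prod_nat_const big_mkcond [RHS]big_mkcond; apply: eq_bigr => x _ /=.
    by rewrite inE; case: (x \in A).
  rewrite [X in (_ * X)%N](_ : _ =
      \prod_(x in A) if x \in A' then multiplicity t x else 1)%N; last first.
    rewrite big_mkcond [RHS]big_mkcond; apply: eq_bigr => x _ /=.
    by case: (boolP (x \in A')) => [/(subsetP A'A) ->|]; case: (x \in A).
  rewrite -big_split /=; apply: leq_prod => x xA.
  case: (boolP (x \in X)) => xX; last first.
    by have [-> ->] := AX x xA xX; rewrite mul1n.
  apply: leq_trans (_ : 2 ^ r * 1 <= _)%N.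
    rewrite muln1; apply: leq_trans (ltnW (ltn_expl r (ltnSn 1))).
    by rewrite -[leqRHS](card_ord r) max_card.
  by rewrite leq_mul2l; case: ifP => [/A'pos ->|]; rewrite ?orbT.
have Nn : N <= 2 * n%:R by rewrite -natrM ler_nat; clear -n_gt0; lia.
have e1r : r.+1%:R * (e1 * r.+1%:R) = eps / 4.
  by rewrite /e1; field; rewrite nat1r pnatr_eq0.
have rr : r%:R <= r.+1%:R :> R by rewrite ler_nat.
have r1 : 1 <= r.+1%:R :> R by rewrite ler1n.
have e1N : 0 <= e1 * N by rewrite mulr_ge0 // ltW.
have XN1 : r.+1%:R * #|X|%:R <= eps / 2 * n%:R.
  apply: le_trans (_ : r.+1%:R * (r.+1%:R * (e1 * N)) <= _).
    by rewrite ler_wpM2l // (le_trans XN) // ler_wpM2r.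
  have -> : r.+1%:R * (r.+1%:R * (e1 * N)) = eps / 4 * N by rewrite -e1r; ring.
  have : eps / 4 * N <= eps / 4 * (2 * n%:R) by rewrite ler_wpM2l // divr_ge0 // ltW.
  lra.
exists t; split=> //.
- apply/forallP => c; rewrite ffunE (subset_trans (subsetIr _ _) Abr) /=.
  by apply: (sum_freeS (subsetIl _ _)); case: (Bsf c).
- have : #|A|%:R <= #|A'|%:R + #|X|%:R :> R.
    rewrite -natrD ler_nat; apply: leq_trans (leq_card_setU _ _).1.
    apply/subset_leq_card/subsetP => x xA; rewrite in_setU.
    by case: (boolP (x \in X)) => xX; rewrite ?orbT // (AX x xA xX).1.
  have : #|X|%:R <= r.+1%:R * #|X|%:R :> R by rewrite ler_peMl.
  have : 0 <= eps * n%:R by rewrite mulr_ge0 // ltW.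
  lra.
apply: le_trans (_ : ((#|C| ^ r) * ((2 ^ r) ^ #|X|
    * \prod_(x in A') multiplicity t x))%:R <= _).
  by rewrite ler_nat (leq_trans fK) // leq_mul2l prodK orbT.
rewrite !natrM -exp_g_tuple // mulrDl [X in _ <= 2 `^ X]addrC powRD; last first.
  by rewrite pnatr_eq0 implybT.
rewrite mulrA ler_wpM2r ?powR_ge0 //.
apply: le_trans (_ : 2 `^ (eps / 2 * n%:R) * 2 `^ (eps / 2 * n%:R) <= _); last first.
  rewrite -powRD ?pnatr_eq0 ?implybT // -mulrDl.
  by rewrite (_ : eps / 2 + eps / 2 = eps) //; field.
apply: ler_pM => //.
  apply: le_trans (_ : (#|small_sets n tau|%:R ^+ (J * r)) <= _).
    by rewrite natrX exprM lerXn2r ?nnegrE -?natrX ?ler0n ?ler_nat.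
  apply: le_trans (_ : (2 `^ (eta * N)) ^+ (J * r) <= _).
    by rewrite lerXn2r ?nnegrE ?powR_ge0.
  rewrite -powR_mulrn ?powR_ge0 // -powRrM ler_powR ?ler1n //.
  have : eta * (J * r).+1%:R = eps / 4.
    by rewrite /eta; move: (J * r)%N => k; field; rewrite nat1r pnatr_eq0.
  have : eta * N * (J * r)%:R <= eta * N * (J * r).+1%:R.
    by rewrite ler_wpM2l ?ler_nat // mulr_ge0 // ltW.
  have : eps / 4 * N <= eps / 4 * (2 * n%:R) by rewrite ler_wpM2l // divr_ge0 // ltW.
  move=> h1 h2 h3.
  have h4 : eta * N * (J * r).+1%:R = eps / 4 * N by rewrite -h3; ring.
  lra.
rewrite -expnM natrX -powR_mulrn // ler_powR ?ler1n // natrM.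
by apply: le_trans XN1; rewrite ler_wpM2r.
Qed.

Theorem theorem3p2 (R : realType) (eps : R) (eps_gt0 : 0 < eps) (r : nat) :
  exists n0 : nat, (0 < n0)%N /\
  forall n : nat, (n0 <= n)%N ->
    (forall A : {set 'I_n.+1}, A \subset bracket n ->
       exists A' : {set 'I_n.+1},
         [/\ A' \subset A,
             #|A|%:R - eps * n%:R <= #|A'|%:R,
             (exp2 (g_set R A r * n%:R%:E) <= (f_set A r)%:R%:E)%E
           & ((f_set A r)%:R%:E <= exp2 ((g_set R A' r + eps%:E) * n%:R%:E))%E])
    /\
    ((g_max R n r <= (log2 (f_max n r)%:R / n%:R)%:E)%E /\
     ((log2 (f_max n r)%:R / n%:R)%:E <= g_max R n r + eps%:E)%E).
Proof.
have l20 := ln2_gt0 R.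
have [n0 upper] := f_set_upper r eps_gt0.
exists n0.+1; split=> // n n0n.
have n_gt0 : (0 < n)%N by exact: leq_trans n0n.
have nR : 0 < n%:R :> R by rewrite ltr0n.
have {}upper := upper n (ltnW n0n) n_gt0.
have lower (t : set_tuple n r) : sum_free_tuple t ->
    2 `^ (g_tuple R t * n%:R) <= (f_set (\bigcup_i t i) r)%:R.
  by move=> tsf; rewrite exp_g_tuple // ler_nat f_set_ge.
have g_set_ge (t : set_tuple n r) : sum_free_tuple t ->
    ((g_tuple R t)%:E <= g_set R (\bigcup_i t i) r)%E.
  by move=> tsf; apply: le_bigmax_cond; rewrite tsf eqxx.
have g_setP A : g_set R A r = -oo%E \/ exists t : set_tuple n r,
    [/\ sum_free_tuple t, \bigcup_i t i = A & g_set R A r = (g_tuple R t)%:E].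
  case: (pickP (fun t : set_tuple n r => sum_free_tuple t && (\bigcup_i t i == A)))
    => [t0 Pt0|none]; last by left; rewrite /g_set big_pred0.
  right; have [||t] := @eq_bigmax _ _ _ (-oo%E : \bar R) t0
    (fun t : set_tuple n r => sum_free_tuple t && (\bigcup_i t i == A))
    (fun t => (g_tuple R t)%:E) => //.
    by move=> t _; rewrite leNye.
  by rewrite unfold_in => /andP[tsf /eqP tA] tE; exists t.
have f_posR (A : {set 'I_n.+1}) : (0 <= (f_set A r)%:R :> R) by [].
have fmax_ge (A : {set 'I_n.+1}) : A \subset bracket n -> (f_set A r <= f_max n r)%N.
  by move=> AB; apply: leq_bigmax_cond.
(* The empty set has a valid colouring even for [r = 0], so [f_max] is positive and its logarithm is
   genuine. *)
have f0 : (0 < f_set (set0 : {set 'I_n.+1}) r)%N.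
  apply: leq_trans (@f_set_ge n r set0 [ffun=> set0] _).
    by rewrite big_set0.
  apply/forallP => c; rewrite ffunE sub0set /=.
  by apply/sum_freeP => x y z; rewrite inE.
have fmax0 : (0 < f_max n r)%N by apply: leq_trans f0 (fmax_ge _ _); rewrite sub0set.
split.
  move=> A AB.
  have low : (exp2 (g_set R A r * n%:R%:E) <= (f_set A r)%:R%:E)%E.
    case: (g_setP A) => [->|[t [tsf <- ->]]].
      by rewrite mulNyr gtr0_sg // mul1e /= lee_fin.
    by rewrite -EFinM /= lee_fin lower.
  (* Without valid colourings [A' = A] works, as [exp2] is nonnegative; otherwise [A'] is the union
     of the pruned containers. *)
  case: (posnP (f_set A r)) => [fA|/upper[] // t [tsf tA tc tf]].
    exists A; split=> //; first by rewrite lerBlDr lerDl mulr_ge0 // ltW.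
    rewrite fA; case: (_ * _)%E => [y| |] //=; rewrite ?lee_fin ?powR_ge0 //.
    by rewrite leey.
  exists (\bigcup_i t i); split=> //.
  case: (g_setP (\bigcup_i t i)) (g_set_ge t tsf) => [->|[t' [_ _ ->]]] //.
  rewrite lee_fin => tt'; rewrite -EFinD -EFinM /= lee_fin (le_trans tf) //.
  by rewrite ler_powR ?ler1n // ler_wpM2r // lerD2r.
split.
  apply/bigmax_leP; split=> [|t tsf]; first by rewrite leNye.
  rewrite lee_fin ler_pdivlMr // /log2 ler_pdivlMr // -ler_expR -powR2E.
  rewrite lnK ?posrE ?ltr0n // (le_trans (lower t tsf)) // ler_nat fmax_ge //.
  by apply/bigcupsP => c _; have /forallP/(_ c)/andP[] := tsf.
have [A AB fE] : exists2 A : {set 'I_n.+1}, A \subset bracket n & f_max n r = f_set A r.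
  have [|A] := @eq_bigmax_cond _ (fun A : {set 'I_n.+1} => A \subset bracket n)
    (fun A => f_set A r); last by exists A.
  by apply/card_gt0P; exists set0; rewrite unfold_in sub0set.
(* The tuple found for a maximising [A] is itself a competitor in [g_max]. *)
have [|t [tsf _ _ tf]] := upper A AB; first by rewrite -fE.
apply: le_trans (_ : (g_tuple R t + eps)%:E <= _)%E.
  rewrite lee_fin ler_pdivrMr // /log2 ler_pdivrMr // -ler_expR -powR2E.
  by rewrite lnK ?posrE ?ltr0n // fE.
by rewrite EFinD leeD2r //; apply: le_bigmax_cond.
Qed.
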